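(* $\operatorname{Spec}(\mathrm{QLS}(6))=\{6,8,9,\ldots,36\}$. Equivalently, the set of cardinalities of quantum Latin squares of order six consists of exactly the integers from $6$ through $36$ except $7$.
   Context: For a nonzero vector $x\in\mathbb{C}^n$, its ray is $[x]=\{\lambda x:\lambda\in\mathbb{C}\setminus\{0\}\}$. A quantum Latin square of order $n$, denoted $\mathrm{QLS}(n)$, is an array $\Phi=(\phi_{ij})_{i,j\in\{0,\dots,n-1\}}$ of unit vectors $\phi_{ij}\in\mathbb{C}^n$ such that every row and every column is an orthonormal basis of $\mathbb{C}^n$. Its cardinality is $\operatorname{card}(\Phi)=|\{[\phi_{ij}]: i,j\in\{0,\dots,n-1\}\}|$, the number of distinct rays among its entries. The cardinality spectrum is $\operatorname{Spec}(\mathrm{QLS}(n))=\{\operatorname{card}(\Phi):\Phi\text{ is a }\mathrm{QLS}(n)\}$. *)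

(* Defs.v *)
From mathcomp Require Import all_boot all_order all_algebra.
From mathcomp Require Import complex finmap.
From mathcomp Require Import boolp classical_sets functions cardinality reals.

Set Implicit Arguments.
Unset Strict Implicit.
Unset Printing Implicit Defensive.

Import GRing.Theory.
Local Open Scope ring_scope.
Local Open Scope complex_scope.
Local Open Scope classical_set_scope.

Definition ray (R : realType) (n : nat) (x : 'rV[R[i]]_n) : set 'rV[R[i]]_n :=
  [set y | exists l : R[i], l != 0 /\ y = l *: x].

Definition orthonormal_basis (R : realType) (n : nat) (s : seq 'rV[R[i]]_n) :
    Prop :=
  orthonormal (@dotmx R[i] n) s /\ basis_of fullv s.

Definition is_QLS (R : realType) (n : nat)
    (Phi : 'I_n -> 'I_n -> 'rV[R[i]]_n) : Prop :=
  [/\ forall i j, dotmx (Phi i j) (Phi i j) = 1,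
      forall i, orthonormal_basis [seq Phi i j | j : 'I_n]
    & forall j, orthonormal_basis [seq Phi i j | i : 'I_n]].

Definition rays (R : realType) (n : nat)
    (Phi : 'I_n -> 'I_n -> 'rV[R[i]]_n) : set (set 'rV[R[i]]_n) :=
  [set r | exists i j, r = ray (Phi i j)].

(* The set of rays is always finite (it is indexed by 'I_n * 'I_n), so
   fset_set never takes its default value here; this is recorded below. *)
Definition card_QLS (R : realType) (n : nat)
    (Phi : 'I_n -> 'I_n -> 'rV[R[i]]_n) : nat :=
  #|` fset_set (rays Phi)|%fset.

Lemma finite_rays (R : realType) (n : nat)
    (Phi : 'I_n -> 'I_n -> 'rV[R[i]]_n) : finite_set (rays Phi).
Proof.
have -> : rays Phi = (fun p : 'I_n * 'I_n => ray (Phi p.1 p.2)) @` setT.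
  apply/seteqP; split => r /=.
    by move=> [i [j ->]]; exists (i, j).
  by move=> [[i j] _ <-]; exists i, j.
exact/finite_image/finite_finset.
Qed.

Definition Spec_QLS (R : realType) (n : nat) : set nat :=
  [set k | exists Phi : 'I_n -> 'I_n -> 'rV[R[i]]_n,
             is_QLS Phi /\ card_QLS Phi = k].

(* Main.v *)
(** A ray outside the first row is spanned by a vector x with at least two
    nonzero coordinates in the basis formed by that row. The two corresponding
    rays of the first row are not orthogonal to x, hence do not occur in the row
    of x, so there are at least n + 2 rays: cardinality n + 1 is impossible.

    The other cardinalities from 6 to 36 are realised by explicit orthogonal
    vectors, whose coordinates are Gaussian integers times square roots of
    integer weights, and which are then normalised. *)

Require Import Defs.
From Stdlib Require Import BinInt.
From mathcomp Require Import all_boot classical_sets reals.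
From mathcomp Require Import all_order all_algebra complex finmap.
From mathcomp Require Import boolp functions cardinality.
From mathcomp Require Import ssrZ ring.

Set Implicit Arguments.
Unset Strict Implicit.
Unset Printing Implicit Defensive.

Import Order.TTheory GRing.Theory Num.Theory.
Local Open Scope ring_scope.
Local Open Scope classical_set_scope.

(** * Counting elements of finite sets; rays and orthonormal bases *)

Lemma leq_card_fset_set (T : choiceType) (A : set T) (s : seq T) :
  finite_set A -> uniq s -> (forall x, x \in s -> A x) ->
  (size s <= #|` fset_set A|%fset)%N.
Proof.
move=> Afin us sA; apply: uniq_leq_size us _ => x xs.
by rewrite in_fset_set//; apply/mem_set/sA.
Qed.

Lemma card_fset_set_seq (T : choiceType) (A : set T) (s : seq T) :
  uniq s -> (forall x, A x <-> x \in s) -> #|` fset_set A|%fset = size s.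
Proof.
move=> us As.
have Afin : finite_set A.
  have -> : A = [set` s] by apply/seteqP; split=> x; rewrite /= As.
  exact: finite_seq.
apply/eqP; rewrite eqn_leq leq_card_fset_set//; last by move=> x /As.
rewrite andbT; apply: uniq_leq_size (fset_uniq _) _ => x.
by rewrite in_fset_set// => /set_mem/As.
Qed.

Lemma rayZ (R : realType) n (a : R[i]) (x : 'rV[R[i]]_n) :
  a != 0 -> ray (a *: x) = ray x.
Proof.
move=> a0; apply/seteqP; split=> y [l [l0 ->]].
  by exists (l * a); rewrite mulf_neq0// scalerA.
by exists (l / a); rewrite mulf_neq0 ?invr_eq0// scalerA divfK.
Qed.

Lemma ray_eq (R : realType) n (x y : 'rV[R[i]]_n) :
  ray x = ray y -> exists2 l : R[i], l != 0 & x = l *: y.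
Proof.
move=> xy; have : ray x x by exists 1; rewrite oner_eq0 scale1r.
by rewrite xy => -[l [l0 ->]]; exists l.
Qed.

(** Orthonormal vectors are free, and [n] of them fill a space of dimension [n], which gives the
    basis property. The family is injective because [f i = f j] with [i != j] would force 1 = 0.
    From here on only Gram matrices need to be handled. *)
Lemma orthonormal_basisP (R : realType) n (f : 'I_n -> 'rV[R[i]]_n) :
  orthonormal_basis [seq f i | i : 'I_n] <->
  forall i j, dotmx (f i) (f j) = (i == j)%:R.
Proof.
split=> [[/orthonormalP[us fP] _] i j|fP].
  have finj : injective f by move/injectiveP : us.
  by rewrite fP ?codom_f// (inj_eq finj).
have finj : injective f.
  move=> i j fij; apply/eqP; move: (fP i i); rewrite {2}fij fP eqxx.
  by case: eqP => // _ /esym/eqP; rewrite oner_eq0.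
have onf : orthonormal (@dotmx R[i] n) [seq f i | i : 'I_n].
  apply/orthonormalP; split; first exact/injectiveP.
  move=> _ _ /codomP[i ->] /codomP[j ->]; rewrite [LHS]fP.
  by rewrite (inj_eq finj).
split=> //; rewrite basisEfree (orthonormal_free onf) subvf size_image.
by rewrite dimvf dim_matrix mul1r card_ord /=.
Qed.

Lemma is_QLSP (R : realType) n (Phi : 'I_n -> 'I_n -> 'rV[R[i]]_n) :
  is_QLS Phi <->
  (forall i j k, dotmx (Phi i j) (Phi i k) = (j == k)%:R) /\
  (forall i j k, dotmx (Phi j i) (Phi k i) = (j == k)%:R).
Proof.
split=> [[_ rowP colP]|[rowP colP]].
  by split=> i; apply/orthonormal_basisP.
split=> [i j|i|j]; first by rewrite rowP eqxx.
  exact/orthonormal_basisP.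
exact/orthonormal_basisP.
Qed.

(** If [f i] is a nonzero multiple [l] of [f j], the inner product of the two is [l], hence nonzero,
    so [i] and [j] cannot differ. *)
Lemma row_ray_inj (R : realType) n (f : 'I_n -> 'rV[R[i]]_n) :
  (forall i j, dotmx (f i) (f j) = (i == j)%:R) ->
  injective (fun i => ray (f i)).
Proof.
move=> fP i j /= /ray_eq[l l0 fij]; apply/eqP; move: (fP i j).
rewrite fij linearZl_LR /= fP eqxx mulr1.
by case: eqP => // _ /eqP; rewrite (negPf l0).
Qed.

Lemma orthonormal_ortho0 (R : realType) n (f : 'I_n -> 'rV[R[i]]_n) x :
  (forall i j, dotmx (f i) (f j) = (i == j)%:R) ->
  (forall i, dotmx x (f i) = 0) -> x = 0.
Proof.
move=> /orthonormal_basisP[_ /andP[/eqP fspan _]] xf.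
apply/eqP; rewrite -(dnorm_eq0 (@dotmx R[i] n)); apply/eqP.
have : x \in <<in_tuple [seq f i | i : 'I_n]>>%VS by rewrite fspan memvf.
(* Only the right argument of [dotmx x x] is expanded in the basis, so every term is a multiple of
   some inner product of [x] with a basis vector. *)
move=> /coord_span; set c := coord _ => {2}->.
rewrite linear_sumr big1// => k _; rewrite linearZr_LR /=.
have /codomP[i ->] : [seq f i | i : 'I_n]`_k \in [seq f i | i : 'I_n].
  by rewrite mem_nth.
by rewrite xf mulr0.
Qed.

(** * Bounds on the number of rays: the gap just above the order, and the square of the order *)

(** Either every ray already occurs in row 0, and the count is the order, or some entry [x] has a
    ray outside row 0. In the second case the rays in the row of [x], together with two rays of row
    0, are [n.+3] distinct rays. *)
Lemma card_QLS_eq_or_ge (R : realType) n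
    (Phi : 'I_n.+1 -> 'I_n.+1 -> 'rV[R[i]]_n.+1) :
  is_QLS Phi -> card_QLS Phi = n.+1 \/ (n.+3 <= card_QLS Phi)%N.
Proof.
move=> /is_QLSP[rowP _].
have row_uniq i : uniq [seq ray (Phi i j) | j : 'I_n.+1].
  by apply/injectiveP; apply: row_ray_inj.
have [all0|] := pselect (forall i j,
    ray (Phi i j) \in [seq ray (Phi 0 k) | k : 'I_n.+1]).
  left; rewrite /card_QLS.
  rewrite (@card_fset_set_seq _ _ [seq ray (Phi 0 k) | k : 'I_n.+1])//.
    by rewrite size_image card_ord.
  move=> r; split=> [[i [j ->]]|/codomP[k ->]]; first exact: all0.
  by exists 0, k.
move=> /existsNP[i /existsNP[j /negP xN]]; right.
set x := Phi i j in xN.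
have x1 : dotmx x x = 1 by rewrite rowP eqxx.
(* Were all coordinates of [x] other than the [k]-th zero, [x] would be a multiple of [Phi 0 k],
   nonzero since [x] has norm 1, and its ray would lie in row 0. *)
have coef (k : 'I_n.+1) : exists2 l, l != k & dotmx x (Phi 0 l) != 0.
  apply: contrapT => noL; move: xN; apply/negP; rewrite negbK.
  have xE : x = dotmx x (Phi 0 k) *: Phi 0 k.
    apply/eqP; rewrite -subr_eq0; apply/eqP.
    apply: (@orthonormal_ortho0 _ _ (Phi 0)) => // l.
    rewrite linearBl linearZl_LR /= rowP.
    have [<-|kl] := eqVneq k l; first by rewrite mulr1 subrr.
    rewrite mulr0 subr0; apply: contrapT => /eqP xl; apply: noL.
    by exists l => //; rewrite eq_sym.
  have xk0 : dotmx x (Phi 0 k) != 0.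
    apply: contraTneq (oner_neq0 R[i]) => xk0.
    by rewrite -x1 xE xk0 scale0r linear0l eqxx.
  by rewrite xE rayZ// codom_f.
(* The index 0 is arbitrary and serves only to obtain a first index [k]; excluding [k] then yields a
   second index [l] distinct from it. *)
have [k _ xk] := coef 0; have [l lk xl] := coef k.
(* Suppose the ray of [Phi 0 m] is that of an entry [Phi i p]. If [p = j], the ray of [x] would
   occur in row 0; otherwise [Phi i p] is orthogonal to [x], and so is [Phi 0 m]. *)
have Nrow m : dotmx x (Phi 0 m) != 0 ->
    ray (Phi 0 m) \notin [seq ray (Phi i j) | j : 'I_n.+1].
  move=> xm; apply/negP => /codomP[p mp].
  have [pj|pj] := eqVneq j p; first by move: xN; rewrite /x pj -mp codom_f.
  have [a a0 mE] := ray_eq mp.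
  by move: xm; rewrite mE linearZr_LR /= rowP (negPf pj) mulr0 eqxx.
have -> : n.+3 = size (ray (Phi 0 k) :: ray (Phi 0 l) ::
    [seq ray (Phi i j) | j : 'I_n.+1]).
  by rewrite /= size_image card_ord.
apply: leq_card_fset_set; first exact: finite_rays.
  rewrite !cons_uniq row_uniq in_cons negb_or !Nrow// !andbT.
  by apply: contra lk => /eqP/(row_ray_inj (rowP 0)) ->.
move=> r; rewrite !inE => /orP[/eqP ->|/orP[/eqP ->|/codomP[m ->]]].
- by exists 0, k.
- by exists 0, l.
- by exists i, m.
Qed.

Lemma card_QLS_le (R : realType) n (Phi : 'I_n -> 'I_n -> 'rV[R[i]]_n) :
  (card_QLS Phi <= n * n)%N.
Proof.
pose s := undup [seq ray (Phi p.1 p.2) | p : 'I_n * 'I_n].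
rewrite /card_QLS (@card_fset_set_seq _ _ s) ?undup_uniq//.
  by rewrite (leq_trans (size_undup _))// size_image card_prod card_ord.
move=> r; rewrite mem_undup; split=> [[i [j ->]]|/codomP[[i j] ->]].
  exact: (codom_f _ (i, j)).
by exists i, j.
Qed.

(** * Integer arithmetic for inner products of weighted Gaussian vectors *)

(* The pair [(a, b)] encodes the Gaussian integer [a + b i], and [c] lists the
   weights of the six coordinates: [hdot c] is the Hermitian form pulled back
   along [wvec c], which scales the [k]-th coordinate by [sqrt c_k]. *)
Definition hdot (c : seq Z) (u v : seq (Z * Z)) : Z * Z :=
  let sum (f : nat -> Z) := foldr (fun k s => f k + s) 0 (iota 0 6) in
  let u_ k := nth (0, 0) u k in let v_ k := nth (0, 0) v k in
  (sum (fun k => nth 0 c k * ((u_ k).1 * (v_ k).1 + (u_ k).2 * (v_ k).2)),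
   sum (fun k => nth 0 c k * ((u_ k).2 * (v_ k).1 - (u_ k).1 * (v_ k).2))).

Definition gaussC (C : numClosedFieldType) (z : Z * Z) : C :=
  (int_of_Z z.1)%:~R + 'i * (int_of_Z z.2)%:~R.

Definition wvec (C : numClosedFieldType) (c : seq Z) (u : seq (Z * Z)) :
    'rV[C]_6 :=
  \row_k (sqrtC (int_of_Z (nth 0 c k))%:~R * gaussC C (nth (0, 0) u k)).

Lemma foldr_sum (V : nmodType) (f : nat -> V) s :
  foldr (fun k x => f k + x) 0 s = \sum_(k <- s) f k.
Proof. by elim: s => [|k s IHs] /=; rewrite ?big_nil// big_cons IHs. Qed.

Lemma gaussC_mul_conj (C : numClosedFieldType) (z w : Z * Z) :
  gaussC C z * (gaussC C w)^* =
  gaussC C (z.1 * w.1 + z.2 * w.2, z.2 * w.1 - z.1 * w.2).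
Proof.
have zC (a : Z) : ((int_of_Z a)%:~R : C)^* = (int_of_Z a)%:~R.
  by rewrite conj_Creal ?realz.
rewrite /gaussC [in LHS]rmorphD [in LHS]rmorphM /= conjCi !zC.
rewrite !(rmorphD, rmorphB, rmorphM) /=.
by ring: (sqrCi C).
Qed.

(** Real and imaginary parts recover the two integers, so orthogonality in the field can be decided
    by computing in [Z]. *)
Lemma gaussC_eq0 (C : numClosedFieldType) (z : Z * Z) :
  (gaussC C z == 0) = (z == (0, 0)).
Proof.
apply/idP/eqP => [|->]; last by rewrite /gaussC /= mulr0 addr0.
rewrite /gaussC => /eqP z0.
have zR (a : Z) : ((int_of_Z a)%:~R : C) \is Num.real by rewrite realz.
have zI (a : Z) : ((int_of_Z a)%:~R : C) = 0 -> a = 0.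
  by move/eqP; rewrite intr_eq0 => /eqP a0; rewrite -[a]int_of_ZK a0.
have Re0 := Re_rect (zR z.1) (zR z.2); have Im0 := Im_rect (zR z.1) (zR z.2).
rewrite z0 raddf0 in Re0; rewrite z0 raddf0 in Im0.
by rewrite [z]surjective_pairing [z.1]zI// [z.2]zI.
Qed.

(** A nonnegative weight has a real square root, so the root times its conjugate is the weight
    itself, and the irrational factors disappear from every inner product. *)
Lemma dotmx_wvec (C : numClosedFieldType) (c : seq Z) (u v : seq (Z * Z)) :
  all (fun x => 0 <= x) c ->
  dotmx (wvec C c u) (wvec C c v) = gaussC C (hdot c u v).
Proof.
move=> /allP c0; rewrite dotmxE mxE.
have gaussC_sum (f g : nat -> Z) s :
    gaussC C (\sum_(k <- s) f k, \sum_(k <- s) g k) =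
    \sum_(k <- s) gaussC C (f k, g k).
  elim: s => [|k s IHs]; first by rewrite !big_nil /gaussC /= mulr0 addr0.
  by rewrite !big_cons -IHs /gaussC /= !rmorphD /= mulrDr addrACA.
rewrite /hdot !foldr_sum gaussC_sum -[iota 0 6]/(index_iota 0 6) big_mkord.
apply: eq_bigr => k _; rewrite !mxE rmorphM mulrACA gaussC_mul_conj.
set a := nth 0 c k.
(* An index past the end of [c] reads the default weight 0, which is nonnegative as well. *)
have a0 : 0 <= (int_of_Z a)%:~R :> C.
  rewrite ler0z /a; have [kc|kc] := ltnP k (size c).
    by have := c0 _ (mem_nth 0 kc); case: (nth 0 c k).
  by rewrite nth_default.
rewrite [X in _ * X * _]geC0_conj ?sqrtC_ge0// -expr2 sqrtCK.
by rewrite /gaussC /= !rmorphM /= mulrDr mulrCA.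
Qed.

Lemma hdot_self (c : seq Z) (u : seq (Z * Z)) :
  hdot c u u = ((hdot c u u).1, 0).
Proof.
rewrite [LHS]surjective_pairing; congr pair.
rewrite /hdot !foldr_sum [LHS]/=.
by rewrite big1// => k _; rewrite [_ * (nth _ u k).1]mulrC subrr mulr0.
Qed.

(* Two rays differ exactly when Cauchy-Schwarz is strict. *)
Definition nonparallel (c : seq Z) (u v : seq (Z * Z)) : bool :=
  let h := hdot c u v in
  h.1 * h.1 + h.2 * h.2 != (hdot c u u).1 * (hdot c v v).1.

(** If [x = l *: y], then the squared modulus of the inner product of [x] and [y] and the product of
    their squared norms both equal the squared modulus of [l] times the square of [dotmx y y].
    Injectivity of the integers into the field turns this into the integer equality that
    [nonparallel] denies. *)
Lemma nonparallel_ray (R : realType) (c : seq Z) (u v : seq (Z * Z)) :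
  all (fun x => 0 <= x) c -> nonparallel c u v ->
  ray (wvec R[i] c u) <> ray (wvec R[i] c v).
Proof.
move=> c0 uv /ray_eq[l _ uE]; move: uv; apply/negP; rewrite negbK.
set x := wvec _ c u in uE; set y := wvec _ c v in uE.
have zI (a b : Z) : gaussC R[i] (a, 0) = gaussC R[i] (b, 0) -> a = b.
  rewrite /gaussC /= mulr0 !addr0 => /(intr_inj (R := R[i])) ab.
  by rewrite -[a]int_of_ZK ab int_of_ZK.
have gM (a b : Z) :
    gaussC R[i] (a * b, 0) = gaussC R[i] (a, 0) * gaussC R[i] (b, 0).
  by rewrite /gaussC /= !mulr0 !addr0 !rmorphM.
apply/eqP/zI; rewrite gM -!hdot_self -!dotmx_wvec// -/x -/y.
have -> : forall h : Z * Z, gaussC R[i] (h.1 * h.1 + h.2 * h.2, 0) =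
    gaussC R[i] h * (gaussC R[i] h)^*.
  by move=> h; rewrite gaussC_mul_conj [h.2 * h.1]mulrC subrr.
rewrite -dotmx_wvec// -/x -/y uE !linearZl_LR /= linearZr_LR /= rmorphM /=.
by rewrite [(dotmx y y)^*]geC0_conj ?dnorm_ge0// -!mulrA [dotmx y y * _]mulrCA.
Qed.

(** * Computable certificates for quantum Latin squares *)

Definition table_entry (T : seq (seq (Z * Z))) (i j : nat) : seq (Z * Z) :=
  nth [::] T (6 * i + j)%N.

(** The last clause requires that different lists in the table span different rays. Each ray is thus
    written by one fixed vector throughout the table, and the number of rays is [size (undup T)]. *)
Definition QLS_table (c : seq Z) (T : seq (seq (Z * Z))) : bool :=
  [&& all (fun x => 0 <= x) c, all (fun u => hdot c u u != (0, 0)) T,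
      size T == 36%N,
      all (fun i => all (fun j => all (fun k => (j == k) ||
         (hdot c (table_entry T i j) (table_entry T i k) == (0, 0)) &&
         (hdot c (table_entry T j i) (table_entry T k i) == (0, 0)))
        (iota 0 6)) (iota 0 6)) (iota 0 6) &
      all (fun u => all (fun v => (u == v) || nonparallel c u v) (undup T))
        (undup T)].

(** One formula serves two purposes: with [x = y] nonzero it gives norm 1, and with [x] orthogonal
    to [y] it gives 0. *)
Lemma dotmx_normalize (C : numClosedFieldType) n (x y : 'rV[C]_n) :
  dotmx ((sqrtC (dotmx x x))^-1 *: x) ((sqrtC (dotmx y y))^-1 *: y) =
  dotmx x y / (sqrtC (dotmx x x) * sqrtC (dotmx y y)).
Proof.
rewrite linearZl_LR linearZr_LR /= geC0_conj ?invr_ge0 ?sqrtC_ge0 ?dnorm_ge0//.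
by rewrite invfM mulrA mulrC mulrA [RHS]mulrAC -!mulrA [X in _ = _ * X]mulrC.
Qed.

(** The entries of the table are divided by their norms. This keeps orthogonality and rays, so the
    rays can be counted on the integer vectors. *)
Lemma Spec_QLS_table (R : realType) c T :
  QLS_table c T -> Spec_QLS R 6 (size (undup T)).
Proof.
move=> /and5P[c0 /allP T0 /eqP sT /allP orthoT /allP parT].
pose w u : 'rV[R[i]]_6 := wvec R[i] c u.
pose e (i j : 'I_6) := w (table_entry T i j).
pose Phi i j := (sqrtC (dotmx (e i j) (e i j)))^-1 *: e i j.
have entry_in (i j : 'I_6) : table_entry T i j \in T.
  rewrite mem_nth// sT; have := ltn_ord i; have := ltn_ord j.
  case: i j => i /= _ [j /= _]; rewrite !ltnS => j5 i5.
  by rewrite (@leq_trans (6 * 5 + 5)%N)// leq_add// leq_mul.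
have w0 (i j : 'I_6) : dotmx (e i j) (e i j) != 0.
  by rewrite /e /w dotmx_wvec// gaussC_eq0 T0.
have inI (i : 'I_6) : (i : nat) \in iota 0 6 by rewrite mem_iota ltn_ord.
have rayE i j : ray (Phi i j) = ray (e i j).
  by rewrite rayZ// invr_eq0 sqrtC_eq0 w0.
have Phi1 i j : dotmx (Phi i j) (Phi i j) = 1.
  by rewrite dotmx_normalize -expr2 sqrtCK divff.
exists Phi; split.
  have ortho0 (i j i' j' : 'I_6) :
      hdot c (table_entry T i j) (table_entry T i' j') = (0, 0) ->
      dotmx (Phi i j) (Phi i' j') = 0.
    move=> h; rewrite dotmx_normalize /e /w dotmx_wvec// h /gaussC /=.
    by rewrite mulr0 addr0 mul0r.
  have ortho (i j k : 'I_6) : j != k ->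
      dotmx (Phi i j) (Phi i k) = 0 /\ dotmx (Phi j i) (Phi k i) = 0.
    move=> jk; have /allP/(_ j (inI j))/allP/(_ k (inI k)) := orthoT i (inI i).
    rewrite (inj_eq val_inj) (negPf jk) /= => /andP[/eqP h1 /eqP h2].
    by split; apply: ortho0.
  apply/is_QLSP; split=> i j k; have [<-|jk] := eqVneq j k.
  - exact: Phi1.
  - exact: (ortho i j k jk).1.
  - exact: Phi1.
  - exact: (ortho i j k jk).2.
rewrite /card_QLS (@card_fset_set_seq _ _ [seq ray (w u) | u <- undup T]).
- by rewrite size_map.
- rewrite map_inj_in_uniq ?undup_uniq// => u v uT vT uv.
  have /allP/(_ v vT)/orP[/eqP//|/(nonparallel_ray (R := R) c0)] := parT u uT.
  by move/(_ uv).
move=> r; split=> [[i [j ->]]|/mapP[u]].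
  by apply/mapP; exists (table_entry T i j); rewrite ?rayE ?mem_undup.
rewrite mem_undup => uT ->.
(* Conversely, every listed vector occupies a cell: its position in the row-by-row list is split by
   division by 6 into a row (quotient) and a column (remainder). *)
have uT36 : (index u T < 36)%N by rewrite -sT index_mem.
have i6 : (index u T %/ 6 < 6)%N by rewrite ltn_divLR.
have j6 : (index u T %% 6 < 6)%N by rewrite ltn_mod.
exists (Ordinal i6), (Ordinal j6); rewrite rayE /e /table_entry /=.
by rewrite mulnC -divn_eq nth_index.
Qed.

(** * Explicit squares of order six for each cardinality in the spectrum *)

Definition real_table : seq (seq Z) -> seq (seq (Z * Z)) :=
  map (map (fun a => (a, 0))).

(* Exponents of ['i]. *)
Definition phase_table : seq (seq Z) -> seq (seq (Z * Z)) :=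
  map (map (fun e =>
    nth (0, 0) [:: (1, 0); (0, 1); (-1, 0); (0, -1)] (Z.to_nat e))).

Local Open Scope Z_scope.

(** One array for each cardinality, in the order 6, 8, 9, ..., 36. Every row of an array takes two
    lines of three vectors. The vectors are not normalised. *)
Definition squares : seq (seq Z * seq (seq (Z * Z))) :=
  [::
  (* Cardinality 6: a classical Latin square whose symbols form one orthogonal basis. *)
  (nseq 6 1, real_table
   [:: [:: 0;1;0;1;1;0]; [:: 1;0;0;-1;1;0]; [:: 0;0;1;0;0;-1];
       [:: 1;1;0;0;-1;0]; [:: 1;-1;0;1;0;0]; [:: 0;0;1;0;0;1];
       [:: 1;-1;0;1;0;0]; [:: 1;1;0;0;-1;0]; [:: 1;0;0;-1;1;0];
       [:: 0;0;1;0;0;1]; [:: 0;1;0;1;1;0]; [:: 0;0;1;0;0;-1];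
       [:: 0;0;1;0;0;-1]; [:: 0;1;0;1;1;0]; [:: 1;1;0;0;-1;0];
       [:: 1;-1;0;1;0;0]; [:: 0;0;1;0;0;1]; [:: 1;0;0;-1;1;0];
       [:: 1;0;0;-1;1;0]; [:: 0;0;1;0;0;1]; [:: 0;1;0;1;1;0];
       [:: 0;0;1;0;0;-1]; [:: 1;1;0;0;-1;0]; [:: 1;-1;0;1;0;0];
       [:: 0;0;1;0;0;1]; [:: 0;0;1;0;0;-1]; [:: 1;-1;0;1;0;0];
       [:: 0;1;0;1;1;0]; [:: 1;0;0;-1;1;0]; [:: 1;1;0;0;-1;0];
       [:: 1;1;0;0;-1;0]; [:: 1;-1;0;1;0;0]; [:: 0;0;1;0;0;1];
       [:: 1;0;0;-1;1;0]; [:: 0;0;1;0;0;-1]; [:: 0;1;0;1;1;0]]);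
  (* Cardinality 8: a classical Latin square in which one 2 by 2 subsquare has its two symbols, the
     third and fourth unit vectors, replaced by their sum and difference. *)
  (nseq 6 1, real_table
   [:: [:: 0;1;0;0;1;-1]; [:: 1;1;0;0;-1;0]; [:: 1;0;0;0;1;1];
       [:: 0;0;1;1;0;0]; [:: 1;-1;0;0;0;-1]; [:: 0;0;1;-1;0;0];
       [:: 1;1;0;0;-1;0]; [:: 0;0;1;0;0;0]; [:: 0;0;0;1;0;0];
       [:: 1;-1;0;0;0;-1]; [:: 1;0;0;0;1;1]; [:: 0;1;0;0;1;-1];
       [:: 0;0;0;1;0;0]; [:: 1;0;0;0;1;1]; [:: 0;0;1;0;0;0];
       [:: 1;1;0;0;-1;0]; [:: 0;1;0;0;1;-1]; [:: 1;-1;0;0;0;-1];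
       [:: 0;0;1;0;0;0]; [:: 1;-1;0;0;0;-1]; [:: 0;1;0;0;1;-1];
       [:: 1;0;0;0;1;1]; [:: 0;0;0;1;0;0]; [:: 1;1;0;0;-1;0];
       [:: 1;0;0;0;1;1]; [:: 0;1;0;0;1;-1]; [:: 1;-1;0;0;0;-1];
       [:: 0;0;1;-1;0;0]; [:: 1;1;0;0;-1;0]; [:: 0;0;1;1;0;0];
       [:: 1;-1;0;0;0;-1]; [:: 0;0;0;1;0;0]; [:: 1;1;0;0;-1;0];
       [:: 0;1;0;0;1;-1]; [:: 0;0;1;0;0;0]; [:: 1;0;0;0;1;1]]);
  (nseq 6 1, real_table
   [:: [:: -1;0;0;0;0;0]; [:: 0;-1;-1;-1;-1;0]; [:: 0;-1;1;0;0;0];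
       [:: 0;-1;-1;1;1;0]; [:: 0;0;0;-1;1;0]; [:: 0;0;0;0;0;-1];
       [:: 0;-1;1;1;-1;0]; [:: -1;0;0;0;0;0]; [:: 0;0;0;0;0;-1];
       [:: 0;-1;0;-1;0;0]; [:: 0;-1;-1;1;1;0]; [:: 0;0;-1;0;-1;0];
       [:: 0;0;-1;0;-1;0]; [:: 0;-1;-1;1;1;0]; [:: -1;0;0;0;0;0];
       [:: 0;-1;1;1;-1;0]; [:: 0;0;0;0;0;-1]; [:: 0;-1;0;-1;0;0];
       [:: 0;0;0;0;0;-1]; [:: 0;-1;1;0;0;0]; [:: 0;0;0;-1;1;0];
       [:: -1;0;0;0;0;0]; [:: 0;-1;-1;-1;-1;0]; [:: 0;-1;-1;1;1;0];
       [:: 0;-1;0;-1;0;0]; [:: 0;0;0;0;0;-1]; [:: 0;-1;-1;1;1;0];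
       [:: 0;0;-1;0;-1;0]; [:: -1;0;0;0;0;0]; [:: 0;-1;1;1;-1;0];
       [:: 0;-1;-1;1;1;0]; [:: 0;0;0;-1;1;0]; [:: 0;-1;-1;-1;-1;0];
       [:: 0;0;0;0;0;-1]; [:: 0;-1;1;0;0;0]; [:: -1;0;0;0;0;0]]);
  (nseq 6 1, real_table
   [:: [:: 0;0;0;0;1;1]; [:: 0;0;1;0;0;0]; [:: 1;0;0;-1;-1;1];
       [:: 1;0;0;-1;1;-1]; [:: 1;0;0;1;0;0]; [:: 0;1;0;0;0;0];
       [:: 1;0;0;1;0;0]; [:: 1;0;0;-1;-1;1]; [:: 1;0;0;-1;1;-1];
       [:: 0;0;1;0;0;0]; [:: 0;1;0;0;0;0]; [:: 0;0;0;0;1;1];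
       [:: 0;0;0;0;1;-1]; [:: 0;1;0;0;0;0]; [:: 1;0;0;1;1;1];
       [:: 1;0;0;1;-1;-1]; [:: 1;0;0;-1;0;0]; [:: 0;0;1;0;0;0];
       [:: 0;0;1;0;0;0]; [:: 1;0;0;1;1;1]; [:: 1;0;0;1;-1;-1];
       [:: 0;1;0;0;0;0]; [:: 0;0;0;0;1;-1]; [:: 1;0;0;-1;0;0];
       [:: 0;1;0;0;0;0]; [:: 1;0;0;-1;1;-1]; [:: 0;0;1;0;0;0];
       [:: 1;0;0;-1;-1;1]; [:: 0;0;0;0;1;1]; [:: 1;0;0;1;0;0];
       [:: 1;0;0;-1;0;0]; [:: 1;0;0;1;-1;-1]; [:: 0;1;0;0;0;0];
       [:: 1;0;0;1;1;1]; [:: 0;0;1;0;0;0]; [:: 0;0;0;0;1;-1]]);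
  (nseq 6 1, real_table
   [:: [:: 1;0;0;0;0;-1]; [:: 1;-1;1;0;0;1]; [:: 0;1;1;0;0;0];
       [:: 0;0;0;0;1;0]; [:: 1;1;-1;0;0;1]; [:: 0;0;0;1;0;0];
       [:: 1;1;-1;0;0;1]; [:: 0;0;0;1;0;0]; [:: 0;0;0;0;1;0];
       [:: 1;-1;-1;0;0;-1]; [:: 1;0;1;0;0;0]; [:: 0;1;0;0;0;-1];
       [:: 0;0;0;0;1;0]; [:: 1;-1;-1;0;0;-1]; [:: 1;1;-1;0;0;1];
       [:: 0;0;0;1;0;0]; [:: 0;1;0;0;0;-1]; [:: 1;0;1;0;0;0];
       [:: 0;1;1;0;0;0]; [:: 0;0;0;0;1;0]; [:: 1;0;0;0;0;-1];
       [:: 1;-1;1;0;0;1]; [:: 0;0;0;1;0;0]; [:: 1;1;-1;0;0;1];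
       [:: 1;-1;1;0;0;1]; [:: 1;1;0;0;0;0]; [:: 0;0;0;1;0;0];
       [:: 0;0;1;0;0;-1]; [:: 1;-1;-1;0;0;-1]; [:: 0;0;0;0;1;0];
       [:: 0;0;0;1;0;0]; [:: 0;0;1;0;0;-1]; [:: 1;-1;1;0;0;1];
       [:: 1;1;0;0;0;0]; [:: 0;0;0;0;1;0]; [:: 1;-1;-1;0;0;-1]]);
  (nseq 6 1, real_table
   [:: [:: 0;0;0;1;0;0]; [:: 1;0;0;0;-1;0]; [:: 0;0;0;0;0;1];
       [:: 1;0;0;0;1;0]; [:: 0;1;1;0;0;0]; [:: 0;1;-1;0;0;0];
       [:: 0;0;0;0;1;0]; [:: 0;1;-1;0;0;0]; [:: 1;0;0;0;0;0];
       [:: 0;1;1;0;0;0]; [:: 0;0;0;0;0;1]; [:: 0;0;0;1;0;0];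
       [:: 0;0;1;0;0;0]; [:: 0;0;0;1;0;-1]; [:: 0;1;0;0;0;0];
       [:: 0;0;0;1;0;1]; [:: 1;0;0;0;1;0]; [:: 1;0;0;0;-1;0];
       [:: 1;0;0;0;0;0]; [:: 0;0;0;1;0;1]; [:: 0;0;0;0;1;0];
       [:: 0;0;0;1;0;-1]; [:: 0;1;-1;0;0;0]; [:: 0;1;1;0;0;0];
       [:: 0;1;0;0;0;0]; [:: 1;0;0;0;1;0]; [:: 0;0;1;0;0;0];
       [:: 1;0;0;0;-1;0]; [:: 0;0;0;1;0;0]; [:: 0;0;0;0;0;1];
       [:: 0;0;0;0;0;1]; [:: 0;1;1;0;0;0]; [:: 0;0;0;1;0;0];
       [:: 0;1;-1;0;0;0]; [:: 1;0;0;0;-1;0]; [:: 1;0;0;0;1;0]]);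
  (nseq 6 1, real_table
   [:: [:: -1;0;0;0;0;0]; [:: 0;0;-1;1;0;0]; [:: 0;0;0;0;-1;0];
       [:: 0;-1;0;0;0;0]; [:: 0;0;0;0;0;-1]; [:: 0;0;-1;-1;0;0];
       [:: 0;0;-1;0;0;0]; [:: -1;0;0;0;0;0]; [:: 0;-1;0;-1;0;0];
       [:: 0;0;0;0;-1;0]; [:: 0;-1;0;1;0;0]; [:: 0;0;0;0;0;-1];
       [:: 0;0;0;-1;0;-1]; [:: 0;-1;0;0;1;0]; [:: -1;0;0;0;0;0];
       [:: 0;0;0;-1;0;1]; [:: 0;0;-1;0;0;0]; [:: 0;-1;0;0;-1;0];
       [:: 0;-1;0;0;0;0]; [:: 0;0;-1;-1;0;0]; [:: 0;0;0;0;0;-1];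
       [:: -1;0;0;0;0;0]; [:: 0;0;0;0;-1;0]; [:: 0;0;-1;1;0;0];
       [:: 0;0;0;-1;0;1]; [:: 0;-1;0;0;-1;0]; [:: 0;0;-1;0;0;0];
       [:: 0;0;0;-1;0;-1]; [:: -1;0;0;0;0;0]; [:: 0;-1;0;0;1;0];
       [:: 0;0;0;0;-1;0]; [:: 0;0;0;0;0;-1]; [:: 0;-1;0;1;0;0];
       [:: 0;0;-1;0;0;0]; [:: 0;-1;0;-1;0;0]; [:: -1;0;0;0;0;0]]);
  (nseq 6 1, real_table
   [:: [:: 1;0;0;0;0;0]; [:: 0;0;0;0;1;1]; [:: 0;0;0;0;1;-1];
       [:: 0;1;1;0;0;0]; [:: 0;0;0;1;0;0]; [:: 0;1;-1;0;0;0];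
       [:: 0;0;0;0;1;0]; [:: 0;1;0;-1;0;0]; [:: 0;1;0;1;0;0];
       [:: 1;0;0;0;0;-1]; [:: 0;0;1;0;0;0]; [:: 1;0;0;0;0;1];
       [:: 0;1;0;0;0;1]; [:: 1;0;0;0;0;0]; [:: 0;0;1;0;0;0];
       [:: 0;0;0;1;0;0]; [:: 0;1;0;0;0;-1]; [:: 0;0;0;0;1;0];
       [:: 0;1;0;0;0;-1]; [:: 0;0;1;0;0;0]; [:: 1;0;0;0;0;0];
       [:: 0;0;0;0;1;0]; [:: 0;1;0;0;0;1]; [:: 0;0;0;1;0;0];
       [:: 0;0;1;0;0;0]; [:: 0;1;0;1;0;0]; [:: 0;1;0;-1;0;0];
       [:: 1;0;0;0;0;1]; [:: 0;0;0;0;1;0]; [:: 1;0;0;0;0;-1];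
       [:: 0;0;0;1;0;0]; [:: 0;0;0;0;1;-1]; [:: 0;0;0;0;1;1];
       [:: 0;1;-1;0;0;0]; [:: 1;0;0;0;0;0]; [:: 0;1;1;0;0;0]]);
  (nseq 6 1, real_table
   [:: [:: -1;-1;0;0;0;0]; [:: 0;0;-1;1;-1;1]; [:: -1;1;-1;0;1;0];
       [:: 0;0;0;-1;0;1]; [:: 0;0;-1;-1;-1;-1]; [:: -1;1;1;0;-1;0];
       [:: -1;1;1;0;1;0]; [:: -1;-1;0;0;0;0]; [:: 0;0;0;-1;0;0];
       [:: -1;1;-1;0;-1;0]; [:: 0;0;-1;0;1;0]; [:: 0;0;0;0;0;-1];
       [:: 0;0;-1;1;1;1]; [:: -1;1;0;0;0;0]; [:: -1;-1;0;0;0;0];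
       [:: 0;0;-1;-1;1;-1]; [:: 0;0;0;-1;0;1]; [:: 0;0;-1;0;-1;0];
       [:: 0;0;0;-1;0;1]; [:: 0;0;-1;-1;-1;-1]; [:: -1;1;1;0;-1;0];
       [:: -1;-1;0;0;0;0]; [:: 0;0;-1;1;-1;1]; [:: -1;1;-1;0;1;0];
       [:: -1;1;-1;0;-1;0]; [:: 0;0;-1;0;1;0]; [:: 0;0;0;0;0;-1];
       [:: -1;1;1;0;1;0]; [:: -1;-1;0;0;0;0]; [:: 0;0;0;-1;0;0];
       [:: 0;0;-1;-1;1;-1]; [:: 0;0;0;-1;0;1]; [:: 0;0;-1;0;-1;0];
       [:: 0;0;-1;1;1;1]; [:: -1;1;0;0;0;0]; [:: -1;-1;0;0;0;0]]);
  (nseq 6 1, real_table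
   [:: [:: 1;-1;0;0;-1;-1]; [:: 0;0;1;1;0;0]; [:: 1;0;-1;1;0;1];
       [:: 0;1;0;0;-1;0]; [:: 1;0;1;-1;0;1]; [:: 1;1;0;0;1;-1];
       [:: 0;0;1;0;0;0]; [:: 1;0;0;0;0;1]; [:: 0;1;0;0;0;0];
       [:: 1;0;0;0;0;-1]; [:: 0;0;0;0;1;0]; [:: 0;0;0;1;0;0];
       [:: 1;0;0;0;0;1]; [:: 0;1;0;0;1;0]; [:: 1;0;-1;-1;0;-1];
       [:: 0;0;1;-1;0;0]; [:: 1;0;1;1;0;-1]; [:: 0;1;0;0;-1;0];
       [:: 0;1;0;0;-1;0]; [:: 0;0;1;-1;0;0]; [:: 1;0;1;1;0;-1];
       [:: 0;1;0;0;1;0]; [:: 1;0;-1;-1;0;-1]; [:: 1;0;0;0;0;1];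
       [:: 0;0;0;1;0;0]; [:: 1;0;0;0;0;-1]; [:: 0;0;0;0;1;0];
       [:: 1;0;0;0;0;1]; [:: 0;1;0;0;0;0]; [:: 0;0;1;0;0;0];
       [:: 1;1;0;0;1;-1]; [:: 0;1;0;0;-1;0]; [:: 1;0;1;-1;0;1];
       [:: 0;0;1;1;0;0]; [:: 1;0;-1;1;0;1]; [:: 1;-1;0;0;-1;-1]]);
  (nseq 6 1, real_table
   [:: [:: 1;-1;0;1;0;0]; [:: 1;1;0;0;1;0]; [:: 0;1;0;1;-1;0];
       [:: 0;0;1;0;0;0]; [:: 1;0;0;-1;-1;0]; [:: 0;0;0;0;0;1];
       [:: 0;1;0;1;-1;0]; [:: 0;0;1;0;0;0]; [:: 1;0;0;1;1;0];
       [:: 1;-1;0;0;-1;0]; [:: 0;0;0;0;0;1]; [:: 1;1;0;-1;0;0];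
       [:: 0;0;0;0;0;1]; [:: 0;1;0;-1;-1;0]; [:: 1;-1;0;0;-1;0];
       [:: 1;0;0;-1;1;0]; [:: 1;1;0;1;0;0]; [:: 0;0;1;0;0;0];
       [:: 1;0;0;-1;-1;0]; [:: 0;0;0;0;0;1]; [:: 0;0;1;0;0;0];
       [:: 1;1;0;1;0;0]; [:: 0;1;0;-1;1;0]; [:: 1;-1;0;0;1;0];
       [:: 1;1;0;0;1;0]; [:: 1;-1;0;-1;0;0]; [:: 0;0;0;0;0;1];
       [:: 0;1;0;-1;-1;0]; [:: 0;0;1;0;0;0]; [:: 1;0;0;1;-1;0];
       [:: 0;0;1;0;0;0]; [:: 1;0;0;1;-1;0]; [:: 1;1;0;-1;0;0];
       [:: 0;0;0;0;0;1]; [:: 1;-1;0;0;1;0]; [:: 0;1;0;1;1;0]]);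
  (* Cardinality 18: three bases without a common ray, each filling two rows. One is the standard
     basis; the other two consist of sums and differences of unit vectors along two pairings of the
     coordinates. *)
  (nseq 6 1, real_table
   [:: [:: 1;0;0;1;0;0]; [:: 0;0;0;0;1;1]; [:: 0;1;1;0;0;0];
       [:: 1;0;0;-1;0;0]; [:: 0;1;-1;0;0;0]; [:: 0;0;0;0;1;-1];
       [:: 0;1;0;0;-1;0]; [:: 0;0;1;1;0;0]; [:: 1;0;0;0;0;1];
       [:: 0;1;0;0;1;0]; [:: 1;0;0;0;0;-1]; [:: 0;0;1;-1;0;0];
       [:: 0;1;0;0;1;0]; [:: 0;0;1;-1;0;0]; [:: 1;0;0;0;0;-1];
       [:: 0;1;0;0;-1;0]; [:: 1;0;0;0;0;1]; [:: 0;0;1;1;0;0];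
       [:: 0;0;1;0;0;0]; [:: 0;1;0;0;0;0]; [:: 0;0;0;0;1;0];
       [:: 0;0;0;0;0;1]; [:: 0;0;0;1;0;0]; [:: 1;0;0;0;0;0];
       [:: 1;0;0;-1;0;0]; [:: 0;0;0;0;1;-1]; [:: 0;1;-1;0;0;0];
       [:: 1;0;0;1;0;0]; [:: 0;1;1;0;0;0]; [:: 0;0;0;0;1;1];
       [:: 0;0;0;0;0;1]; [:: 1;0;0;0;0;0]; [:: 0;0;0;1;0;0];
       [:: 0;0;1;0;0;0]; [:: 0;0;0;0;1;0]; [:: 0;1;0;0;0;0]]);
  (nseq 6 1, real_table
   [:: [:: 1;-1;0;0;0;-1]; [:: 1;1;-1;0;0;0]; [:: 1;0;1;0;0;1];
       [:: 0;0;0;1;1;0]; [:: 0;0;0;1;-1;0]; [:: 0;1;1;0;0;-1];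
       [:: 1;0;-1;0;0;1]; [:: 0;0;0;1;0;0]; [:: 0;0;0;0;1;0];
       [:: 0;1;-1;0;0;-1]; [:: 1;1;1;0;0;0]; [:: 1;-1;0;0;0;-1];
       [:: 0;0;0;0;1;0]; [:: 0;1;1;0;0;1]; [:: 0;0;0;1;0;0];
       [:: 1;0;1;0;0;-1]; [:: 1;-1;0;0;0;1]; [:: 1;1;-1;0;0;0];
       [:: 0;1;-1;0;0;-1]; [:: 1;0;1;0;0;-1]; [:: 1;-1;-1;0;0;0];
       [:: 1;1;0;0;0;1]; [:: 0;0;0;1;1;0]; [:: 0;0;0;1;-1;0];
       [:: 1;1;1;0;0;0]; [:: 1;-1;0;0;0;1]; [:: 0;1;-1;0;0;1];
       [:: 0;0;0;1;-1;0]; [:: 1;0;-1;0;0;-1]; [:: 0;0;0;1;1;0];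
       [:: 0;0;0;1;0;0]; [:: 0;0;0;0;1;0]; [:: 1;1;0;0;0;-1];
       [:: 1;-1;-1;0;0;0]; [:: 0;1;-1;0;0;1]; [:: 1;0;1;0;0;1]]);
  (nseq 6 1, real_table
   [:: [:: 0;0;1;0;0;0]; [:: 0;0;0;0;0;1]; [:: 0;0;0;1;1;0];
       [:: 0;0;0;1;-1;0]; [:: 1;-1;0;0;0;0]; [:: 1;1;0;0;0;0];
       [:: 0;1;0;0;-1;0]; [:: 1;0;0;-1;0;0]; [:: 0;0;1;0;0;1];
       [:: 0;0;1;0;0;-1]; [:: 1;1;0;1;1;0]; [:: 1;-1;0;1;-1;0];
       [:: 0;0;0;0;0;1]; [:: 0;1;0;0;0;0]; [:: 0;0;0;1;-1;0];
       [:: 1;0;0;0;0;0]; [:: 0;0;1;0;0;0]; [:: 0;0;0;1;1;0];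
       [:: 0;0;0;1;0;0]; [:: 0;0;0;0;1;0]; [:: 1;0;0;0;0;0];
       [:: 0;1;0;0;0;0]; [:: 0;0;0;0;0;1]; [:: 0;0;1;0;0;0];
       [:: 0;1;0;0;1;0]; [:: 1;0;0;1;0;0]; [:: 0;0;1;0;0;-1];
       [:: 0;0;1;0;0;1]; [:: 1;1;0;-1;-1;0]; [:: 1;-1;0;-1;1;0];
       [:: 1;0;0;0;0;0]; [:: 0;0;1;0;0;0]; [:: 0;1;0;0;0;0];
       [:: 0;0;0;1;1;0]; [:: 0;0;0;1;-1;0]; [:: 0;0;0;0;0;1]]);
  (nseq 6 1, real_table
   [:: [:: 1;0;0;-1;0;0]; [:: 1;0;1;1;-1;0]; [:: 0;1;0;0;0;0];
       [:: 0;0;0;0;0;1]; [:: 0;0;1;0;1;0]; [:: 1;0;-1;1;1;0];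
       [:: 0;1;0;0;0;0]; [:: 1;0;-1;0;0;0]; [:: 0;0;0;0;0;1];
       [:: 0;0;0;0;1;0]; [:: 0;0;0;1;0;0]; [:: 1;0;1;0;0;0];
       [:: 1;0;1;1;-1;0]; [:: 0;0;0;0;0;1]; [:: 1;0;0;0;1;0];
       [:: 0;0;1;-1;0;0]; [:: 0;1;0;0;0;0]; [:: 1;0;-1;-1;-1;0];
       [:: 1;0;-1;1;1;0]; [:: 1;0;1;-1;1;0]; [:: 1;0;0;0;-1;0];
       [:: 0;0;1;1;0;0]; [:: 0;0;0;0;0;1]; [:: 0;1;0;0;0;0];
       [:: 0;0;0;0;0;1]; [:: 0;0;0;1;1;0]; [:: 0;0;1;0;0;0];
       [:: 0;1;0;0;0;0]; [:: 1;0;0;0;0;0]; [:: 0;0;0;1;-1;0];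
       [:: 0;0;1;0;1;0]; [:: 0;1;0;0;0;0]; [:: 0;0;0;1;0;0];
       [:: 1;0;0;0;0;0]; [:: 0;0;1;0;-1;0]; [:: 0;0;0;0;0;1]]);
  (nseq 6 1, real_table
   [:: [:: 0;2;0;0;-1;0]; [:: 1;0;-1;0;0;2]; [:: 1;0;1;0;0;0];
       [:: 0;0;0;1;0;0]; [:: 1;0;-1;0;0;-1]; [:: 0;1;0;0;2;0];
       [:: 2;0;-1;1;0;0]; [:: 0;2;0;0;1;0]; [:: 0;1;0;0;-2;0];
       [:: 1;0;2;0;0;-1]; [:: 1;0;0;-2;0;1]; [:: 0;0;1;1;0;2];
       [:: 0;1;0;0;2;0]; [:: 1;0;-1;0;0;-1]; [:: 0;0;0;1;0;0];
       [:: 1;0;0;0;0;1]; [:: 1;0;2;0;0;-1]; [:: 0;2;0;0;-1;0];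
       [:: 0;0;1;1;0;0]; [:: 1;0;1;-1;0;0]; [:: 0;0;0;0;0;1];
       [:: 0;1;0;0;0;0]; [:: 0;0;0;0;1;0]; [:: 2;0;-1;1;0;0];
       [:: 0;0;0;0;0;1]; [:: 1;0;1;2;0;0]; [:: 1;0;-1;0;0;0];
       [:: 0;0;0;0;1;0]; [:: 0;1;0;0;0;0]; [:: 1;0;1;-1;0;0];
       [:: 1;0;1;-1;0;0]; [:: 0;1;0;0;-2;0]; [:: 0;2;0;0;1;0];
       [:: 1;0;-1;0;0;-1]; [:: 1;0;0;1;0;1]; [:: 0;0;1;1;0;-1]]);
  (nseq 6 1, real_table
   [:: [:: 0;1;0;0;-1;0]; [:: 0;1;1;-1;1;0]; [:: 1;0;0;0;0;0];
       [:: 0;0;1;1;0;0]; [:: 0;1;-1;1;1;0]; [:: 0;0;0;0;0;1];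
       [:: 1;0;0;0;0;1]; [:: 0;0;1;0;-1;0]; [:: 0;0;0;1;0;0];
       [:: 0;1;0;0;0;0]; [:: 1;0;0;0;0;-1]; [:: 0;0;1;0;1;0];
       [:: 0;0;0;1;0;0]; [:: 0;0;0;0;0;1]; [:: 0;1;-1;0;0;0];
       [:: 0;0;0;0;1;0]; [:: 0;1;1;0;0;0]; [:: 1;0;0;0;0;0];
       [:: 1;0;0;0;0;-1]; [:: 0;1;-1;-1;-1;0]; [:: 0;1;1;0;0;0];
       [:: 1;0;0;0;0;1]; [:: 0;0;0;1;-1;0]; [:: 0;1;-1;1;1;0];
       [:: 0;1;0;0;1;0]; [:: 1;0;0;0;0;0]; [:: 0;0;0;0;0;1];
       [:: 0;0;1;-1;0;0]; [:: 0;1;-1;-1;-1;0]; [:: 0;1;1;1;-1;0];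
       [:: 0;0;1;0;0;0]; [:: 0;1;0;1;0;0]; [:: 0;0;0;0;1;0];
       [:: 1;0;0;0;0;-1]; [:: 1;0;0;0;0;1]; [:: 0;1;0;-1;0;0]]);
  (nseq 6 1, real_table
   [:: [:: 1;-1;0;1;-1;0]; [:: 0;0;1;0;0;0]; [:: 1;1;0;-1;-1;0];
       [:: 1;0;0;0;1;0]; [:: 0;1;0;1;0;0]; [:: 0;0;0;0;0;1];
       [:: 1;0;0;-1;0;0]; [:: 0;1;0;0;0;1]; [:: 1;0;0;1;0;0];
       [:: 0;1;0;0;0;-1]; [:: 0;0;1;0;1;0]; [:: 0;0;1;0;-1;0];
       [:: 0;1;1;0;-1;1]; [:: 0;1;0;0;0;-1]; [:: 0;1;-1;0;1;1];
       [:: 0;0;0;1;0;0]; [:: 1;0;0;0;0;0]; [:: 0;0;1;0;1;0];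
       [:: 1;1;0;1;1;0]; [:: 1;0;0;0;-1;0]; [:: 1;-1;0;-1;1;0];
       [:: 0;0;1;0;0;0]; [:: 0;0;0;0;0;1]; [:: 0;1;0;-1;0;0];
       [:: 0;1;-1;0;-1;-1]; [:: 0;0;0;1;0;0]; [:: 0;1;1;0;1;-1];
       [:: 0;1;0;0;0;1]; [:: 0;0;1;0;-1;0]; [:: 1;0;0;0;0;0];
       [:: 0;0;1;0;0;-1]; [:: 1;0;0;0;1;0]; [:: 0;0;1;0;0;1];
       [:: 1;0;0;0;-1;0]; [:: 0;1;0;-1;0;0]; [:: 0;1;0;1;0;0]]);
  (nseq 6 1, real_table
   [:: [:: 0;2;-1;0;-1;0]; [:: 1;0;0;0;0;2]; [:: 0;1;2;-1;0;0];
       [:: 0;0;1;2;-1;0]; [:: 2;0;0;0;0;-1]; [:: 0;1;0;1;2;0];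
       [:: 0;1;2;1;0;0]; [:: 0;1;-1;1;0;0]; [:: 0;0;0;0;1;0];
       [:: 0;0;0;0;0;1]; [:: 0;1;0;-1;0;0]; [:: 1;0;0;0;0;0];
       [:: 0;1;0;-1;2;0]; [:: 0;1;0;-1;-1;0]; [:: 0;0;0;0;0;1];
       [:: 1;0;0;0;0;0]; [:: 0;1;0;1;0;0]; [:: 0;0;1;0;0;0];
       [:: 2;0;0;0;0;-1]; [:: 0;1;1;0;1;0]; [:: 0;1;-1;-1;0;0];
       [:: 0;0;1;-1;-1;0]; [:: 1;0;0;0;0;2]; [:: 0;1;0;1;-1;0];
       [:: 1;0;0;0;0;2]; [:: 2;0;0;0;0;-1]; [:: 0;1;0;1;0;0];
       [:: 0;0;1;0;1;0]; [:: 0;0;1;0;-1;0]; [:: 0;1;0;-1;0;0];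
       [:: 0;0;1;-2;-1;0]; [:: 0;0;1;1;-1;0]; [:: 1;0;0;0;0;0];
       [:: 0;1;0;0;0;0]; [:: 0;0;1;0;1;0]; [:: 0;0;0;0;0;1]]);
  (nseq 6 1, real_table
   [:: [:: 0;1;0;-1;0;0]; [:: 0;1;0;1;1;-1]; [:: 0;1;0;1;-1;1];
       [:: 0;0;1;0;0;0]; [:: 0;0;0;0;1;1]; [:: 1;0;0;0;0;0];
       [:: 0;0;0;0;1;0]; [:: 1;0;-1;0;0;0]; [:: 1;0;1;0;0;0];
       [:: 0;0;0;0;0;1]; [:: 0;0;0;1;0;0]; [:: 0;1;0;0;0;0];
       [:: 0;0;1;0;0;-1]; [:: 1;1;1;0;0;1]; [:: 1;1;-1;0;0;-1];
       [:: 0;0;0;0;1;0]; [:: 1;-1;0;0;0;0]; [:: 0;0;0;1;0;0];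
       [:: 0;0;1;0;0;1]; [:: 1;-1;1;0;0;-1]; [:: 1;-1;-1;0;0;1];
       [:: 0;0;0;1;0;0]; [:: 1;1;0;0;0;0]; [:: 0;0;0;0;1;0];
       [:: 0;1;0;1;0;0]; [:: 0;1;0;-1;-1;-1]; [:: 0;1;0;-1;1;1];
       [:: 1;0;0;0;0;0]; [:: 0;0;0;0;1;-1]; [:: 0;0;1;0;0;0];
       [:: 1;0;0;0;0;0]; [:: 0;0;0;1;-1;0]; [:: 0;0;0;1;1;0];
       [:: 0;1;0;0;0;0]; [:: 0;0;1;0;0;0]; [:: 0;0;0;0;0;1]]);
  (nseq 6 1, real_table
   [:: [:: -1;-1;-1;-1;-1;0]; [:: -1;0;1;1;-1;-1]; [:: 0;0;-1;2;-1;2];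
       [:: -1;-2;0;1;2;0]; [:: -2;2;-1;0;1;0]; [:: -1;0;2;-1;0;2];
       [:: -1;0;1;1;-1;1]; [:: -1;-1;-1;-1;-1;0]; [:: -2;2;-1;0;1;0];
       [:: -1;0;2;-1;0;-2]; [:: 0;0;-1;2;-1;-2]; [:: -1;-2;0;1;2;0];
       [:: -2;2;0;-1;1;0]; [:: 0;0;-2;1;1;-2]; [:: 0;-1;-1;-1;1;1];
       [:: -2;-1;-1;0;-2;0]; [:: -1;-1;1;1;1;0]; [:: 0;-1;1;-2;0;-2];
       [:: 0;0;-2;1;1;2]; [:: -2;2;0;-1;1;0]; [:: -1;-1;1;1;1;0];
       [:: 0;-1;1;-2;0;2]; [:: 0;-1;-1;-1;1;-1]; [:: -2;-1;-1;0;-2;0];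
       [:: -1;-2;1;0;2;0]; [:: -1;0;-1;2;0;2]; [:: 0;-1;-2;1;0;-2];
       [:: -1;1;-1;-1;1;0]; [:: -2;-1;0;-1;-2;0]; [:: -1;1;1;1;0;-1];
       [:: -1;0;-1;2;0;-2]; [:: -1;-2;1;0;2;0]; [:: -2;-1;0;-1;-2;0];
       [:: -1;1;1;1;0;1]; [:: 0;-1;-2;1;0;2]; [:: -1;1;-1;-1;1;0]]);
  (nseq 6 1, real_table
   [:: [:: 1;0;-1;-1;0;1]; [:: 0;1;-1;0;1;-1]; [:: 1;0;0;1;0;0];
       [:: 1;0;1;-1;0;-1]; [:: 0;1;0;0;-1;0]; [:: 0;1;1;0;1;1];
       [:: 1;1;1;0;-1;0]; [:: 1;-1;0;1;0;-1]; [:: 0;0;1;0;1;0];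
       [:: 1;1;-1;0;1;0]; [:: 0;0;0;1;0;1]; [:: 1;-1;0;-1;0;1];
       [:: 0;0;0;1;0;1]; [:: 0;0;1;0;1;0]; [:: 0;1;0;0;0;0];
       [:: 0;0;0;1;0;-1]; [:: 1;0;0;0;0;0]; [:: 0;0;1;0;-1;0];
       [:: 0;1;0;0;1;0]; [:: 1;0;0;-1;0;0]; [:: 0;0;0;0;0;1];
       [:: 0;1;0;0;-1;0]; [:: 0;0;1;0;0;0]; [:: 1;0;0;1;0;0];
       [:: 1;0;-1;1;0;-1]; [:: 0;1;1;0;-1;-1]; [:: 1;0;0;-1;0;0];
       [:: 1;0;1;1;0;1]; [:: 0;1;0;0;1;0]; [:: 0;1;-1;0;-1;1];
       [:: 1;-1;1;0;1;0]; [:: 1;1;0;1;0;1]; [:: 0;0;1;0;-1;0];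
       [:: 1;-1;-1;0;-1;0]; [:: 0;0;0;1;0;-1]; [:: 1;1;0;-1;0;-1]]);
  (* One ray occurs six times and another one three times. The array is
     invariant under the cyclic shift of the rows and columns within each half
     combined with a rotation of order 3 in the last two coordinates, whence
     the weights 1 and 3. *)
  ([:: 4;420;8;12;1;3], real_table
   [:: [:: 1;0;0;0;0;0]; [:: 0;0;1;2;-2;6]; [:: 0;0;5;-4;-10;2];
       [:: 0;1;0;0;0;0]; [:: 0;0;1;0;4;0]; [:: 0;0;1;1;-2;-2];
       [:: 0;0;5;-4;2;-6]; [:: 1;0;0;0;0;0]; [:: 0;0;1;2;-8;-4];
       [:: 0;0;1;1;4;0]; [:: 0;1;0;0;0;0]; [:: 0;0;1;0;-2;2];
       [:: 0;0;1;2;10;-2]; [:: 0;0;5;-4;8;4]; [:: 1;0;0;0;0;0];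
       [:: 0;0;1;0;-2;-2]; [:: 0;0;1;1;-2;2]; [:: 0;1;0;0;0;0];
       [:: 0;2;13;5;-14;14]; [:: 0;1;-4;6;56;0]; [:: 0;12;-55;-40;-70;-70];
       [:: 1;0;0;0;0;0]; [:: 0;0;1;2;-2;-6]; [:: 0;0;5;-4;8;-4];
       [:: 0;12;-55;-40;140;0]; [:: 0;2;13;5;-14;-14]; [:: 0;1;-4;6;-28;28];
       [:: 0;0;5;-4;2;6]; [:: 1;0;0;0;0;0]; [:: 0;0;1;2;10;2];
       [:: 0;1;-4;6;-28;-28]; [:: 0;12;-55;-40;-70;70]; [:: 0;2;13;5;28;0];
       [:: 0;0;1;2;-8;4]; [:: 0;0;5;-4;-10;-2]; [:: 1;0;0;0;0;0]]);
  (nseq 6 1, real_table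
   [:: [:: 1;-1;0;-1;1;0]; [:: 0;0;1;0;0;-1]; [:: 1;0;0;1;0;0];
       [:: 0;0;1;0;0;1]; [:: 0;1;0;0;1;0]; [:: 1;1;0;-1;-1;0];
       [:: 1;0;1;0;-1;-1]; [:: 0;1;0;0;0;0]; [:: 0;0;0;0;1;-1];
       [:: 0;0;0;1;0;0]; [:: 1;0;-1;0;0;0]; [:: 1;0;1;0;1;1];
       [:: 1;0;-1;0;-1;1]; [:: 0;0;0;1;0;0]; [:: 0;0;0;0;1;1];
       [:: 0;1;0;0;0;0]; [:: 1;0;1;0;0;0]; [:: 1;0;-1;0;1;-1];
       [:: 0;1;-1;-1;0;-1]; [:: 1;0;0;0;-1;0]; [:: 0;1;1;0;0;0];
       [:: 1;0;0;0;1;0]; [:: 0;0;0;1;0;-1]; [:: 0;1;-1;1;0;1];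
       [:: 1;1;0;1;1;0]; [:: 0;0;1;0;0;1]; [:: 1;0;0;-1;0;0];
       [:: 0;0;1;0;0;-1]; [:: 0;1;0;0;-1;0]; [:: 1;-1;0;1;-1;0];
       [:: 0;1;1;-1;0;1]; [:: 1;0;0;0;1;0]; [:: 0;1;-1;0;0;0];
       [:: 1;0;0;0;-1;0]; [:: 0;0;0;1;0;1]; [:: 0;1;1;1;0;-1]]);
  (* Cardinality 31: the vector (1, -1, 1, -1, 1, 0) occurs once in every row and column, and the
     other 30 rays are distinct. *)
  (nseq 6 1, real_table
   [:: [:: 1;1;-1;-1;0;-1]; [:: 1;1;0;1;1;1]; [:: 0;1;1;-1;-1;1];
       [:: 1;-1;1;-1;1;0]; [:: 1;0;1;1;-1;-1]; [:: 1;-1;-1;0;-1;1];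
       [:: 1;-1;1;-1;1;0]; [:: 1;1;1;0;-1;-1]; [:: 1;-1;0;1;-1;1];
       [:: 1;1;-1;-1;0;1]; [:: 0;1;1;1;1;1]; [:: 1;0;-1;1;1;-1];
       [:: 1;1;1;0;-1;1]; [:: 1;-1;1;-1;1;0]; [:: 1;0;-1;-1;-1;-1];
       [:: 1;1;0;1;1;-1]; [:: 1;-1;-1;1;0;1]; [:: 0;1;-1;-1;1;1];
       [:: 1;0;-1;1;1;1]; [:: 0;1;-1;-1;1;-1]; [:: 1;1;1;1;0;-1];
       [:: 1;-1;-1;0;-1;-1]; [:: 1;1;0;-1;-1;1]; [:: 1;-1;1;-1;1;0];
       [:: 1;-1;0;1;-1;-1]; [:: 1;0;-1;-1;-1;1]; [:: 1;-1;1;-1;1;0];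
       [:: 0;1;1;-1;-1;-1]; [:: 1;1;-1;0;1;-1]; [:: 1;1;1;1;0;1];
       [:: 0;1;1;1;1;-1]; [:: 1;-1;-1;1;0;-1]; [:: 1;1;-1;0;1;1];
       [:: 1;0;1;1;-1;1]; [:: 1;-1;1;-1;1;0]; [:: 1;1;0;-1;-1;-1]]);
  (nseq 6 1, real_table
   [:: [:: 1;0;0;-1;1;1]; [:: 0;1;-1;1;0;1]; [:: 0;1;-1;-1;0;-1];
       [:: 1;1;1;0;-1;0]; [:: 1;0;0;1;1;-1]; [:: 1;-1;-1;0;-1;0];
       [:: 1;1;1;1;0;0]; [:: 0;0;0;0;1;0]; [:: 0;0;1;-1;0;0];
       [:: 1;-1;0;0;0;0]; [:: 1;1;-1;-1;0;0]; [:: 0;0;0;0;0;1];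
       [:: 1;0;0;-1;-1;-1]; [:: 0;1;1;-1;0;1]; [:: 0;1;1;1;0;-1];
       [:: 1;1;-1;0;1;0]; [:: 1;0;0;1;-1;1]; [:: 1;-1;1;0;1;0];
       [:: 0;1;-1;0;-1;1]; [:: 0;1;0;0;0;-1]; [:: 1;0;0;0;0;0];
       [:: 0;0;0;1;0;0]; [:: 0;1;1;0;1;1]; [:: 0;0;1;0;-1;0];
       [:: 1;-1;-1;1;0;0]; [:: 0;0;1;1;0;0]; [:: 0;0;0;0;1;0];
       [:: 0;0;0;0;0;1]; [:: 1;-1;1;-1;0;0]; [:: 1;1;0;0;0;0];
       [:: 0;1;-1;0;1;-1]; [:: 1;0;0;0;0;0]; [:: 0;1;0;0;0;1];
       [:: 0;0;1;0;1;0]; [:: 0;1;1;0;-1;-1]; [:: 0;0;0;1;0;0]]);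
  (* Cardinality 33: all coordinates are powers of ['i], so every row and every column of the array
     forms a complex Hadamard matrix. The first coordinate is always 1, and three rays occur
     twice. *)
  (nseq 6 1, phase_table
   [:: [:: 0;0;1;2;0;1]; [:: 0;3;3;2;2;2]; [:: 0;0;3;0;1;0];
       [:: 0;2;1;3;2;0]; [:: 0;1;2;1;3;3]; [:: 0;2;0;0;0;2];
       [:: 0;1;0;1;2;2]; [:: 0;0;2;1;0;3]; [:: 0;1;2;3;3;1];
       [:: 0;3;0;2;0;1]; [:: 0;2;1;0;1;0]; [:: 0;3;3;3;2;3];
       [:: 0;0;2;0;3;3]; [:: 0;3;0;0;1;0]; [:: 0;0;0;2;0;2];
       [:: 0;2;2;1;1;2]; [:: 0;1;3;3;2;1]; [:: 0;2;1;2;3;0];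
       [:: 0;2;1;0;1;0]; [:: 0;1;3;0;3;1]; [:: 0;2;3;2;2;3];
       [:: 0;0;1;1;3;3]; [:: 0;3;2;3;0;2]; [:: 0;0;0;2;1;1];
       [:: 0;2;3;3;3;1]; [:: 0;1;1;3;1;2]; [:: 0;2;1;1;0;0];
       [:: 0;0;3;0;1;0]; [:: 0;3;0;2;2;3]; [:: 0;0;2;1;3;2];
       [:: 0;3;3;2;1;3]; [:: 0;2;1;2;3;0]; [:: 0;3;1;0;2;2];
       [:: 0;1;3;3;3;2]; [:: 0;0;0;1;0;1]; [:: 0;1;2;0;1;0]]);
  (nseq 6 1, real_table
   [:: [:: 0;0;0;1;0;0]; [:: 1;0;-1;0;0;0]; [:: 0;1;0;0;0;0];
       [:: 0;0;0;0;0;1]; [:: 0;0;0;0;1;0]; [:: 1;0;1;0;0;0];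
       [:: 0;1;-2;0;0;0]; [:: 1;2;1;0;0;-2]; [:: 0;0;0;2;1;0];
       [:: 0;0;0;1;-2;0]; [:: 2;0;0;0;0;1]; [:: 1;-2;-1;0;0;-2];
       [:: 0;2;1;0;-1;2]; [:: 1;-1;1;-1;-1;0]; [:: 1;0;-2;1;-2;0];
       [:: 2;0;1;2;1;0]; [:: 1;2;0;-1;0;-2]; [:: 1;0;-1;-1;1;1];
       [:: 0;2;1;0;1;-2]; [:: 1;0;1;1;1;1]; [:: 1;0;-2;-1;2;0];
       [:: 2;0;1;-2;-1;0]; [:: 1;-2;0;1;0;-2]; [:: 1;1;-1;1;-1;0];
       [:: 0;0;0;0;2;1]; [:: 0;2;0;-1;-1;2]; [:: 2;0;1;0;0;0];
       [:: 1;0;-2;0;0;0]; [:: 0;1;0;2;0;0]; [:: 0;2;0;-1;1;-2];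
       [:: 1;0;0;0;0;0]; [:: 0;0;0;1;-1;0]; [:: 0;0;0;0;0;1];
       [:: 0;1;0;0;0;0]; [:: 0;0;1;0;0;0]; [:: 0;0;0;1;1;0]]);
  (nseq 6 1, real_table
   [:: [:: 1;1;-1;1;0;0]; [:: 0;0;0;0;1;1]; [:: 0;1;1;0;2;-2];
       [:: 1;0;0;-1;0;0]; [:: 1;-1;1;1;0;0]; [:: 0;2;2;0;-1;1];
       [:: 1;-1;1;1;0;2]; [:: 1;1;1;-1;0;0]; [:: 3;-2;-2;-1;1;-1];
       [:: 0;1;-1;0;1;1]; [:: 1;1;-1;1;-2;0]; [:: 1;1;1;3;2;-2];
       [:: 1;0;1;0;-1;-1]; [:: 0;1;0;1;0;0]; [:: 1;2;0;-2;0;1];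
       [:: 0;0;1;0;1;0]; [:: 1;0;-1;0;1;-1]; [:: 2;-1;0;1;0;2];
       [:: 1;1;-1;-3;-2;2]; [:: 2;0;-2;0;1;-1]; [:: 4;1;3;2;-4;-2];
       [:: 1;-2;0;1;0;2]; [:: 1;3;1;1;2;2]; [:: 2;-2;4;-4;3;-1];
       [:: 2;-3;-2;-1;1;-1]; [:: 1;0;-1;0;-2;2]; [:: 2;-2;4;1;3;4];
       [:: 2;1;0;2;0;-1]; [:: 2;1;2;-3;-1;-1]; [:: 1;4;-3;-2;4;2];
       [:: 1;1;1;-1;2;0]; [:: 1;-1;1;1;0;0]; [:: 1;2;-2;3;1;1];
       [:: 0;1;1;0;-1;1]; [:: 1;-1;-1;-1;0;2]; [:: 3;1;-1;-1;-2;-2]]);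
  (* Cardinality 36: no ray is repeated. *)
  (nseq 6 1, real_table
   [:: [:: 1;1;0;-1;-1;0]; [:: 0;1;1;1;0;1]; [:: 0;1;-1;1;0;-1];
       [:: 1;0;1;0;1;-1]; [:: 1;-1;0;1;-1;0]; [:: 1;0;-1;0;1;1];
       [:: 1;0;1;1;0;1]; [:: 1;1;0;0;1;-1]; [:: 1;-1;0;0;-1;-1];
       [:: 0;1;1;-1;-1;0]; [:: 1;0;-1;-1;0;1]; [:: 0;1;-1;1;-1;0];
       [:: 1;-1;0;-1;1;0]; [:: 0;1;-1;-1;0;1]; [:: 0;1;1;-1;0;-1];
       [:: 1;0;-1;0;-1;-1]; [:: 1;1;0;1;1;0]; [:: 1;0;1;0;-1;1];
       [:: 0;0;1;0;0;-1]; [:: 1;0;0;0;-1;0]; [:: 1;0;0;0;1;0];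
       [:: 0;1;0;1;0;0]; [:: 0;0;1;0;0;1]; [:: 0;1;0;-1;0;0];
       [:: 0;1;0;0;1;0]; [:: 0;0;1;-1;0;0]; [:: 0;0;1;1;0;0];
       [:: 1;0;0;0;0;1]; [:: 0;1;0;0;-1;0]; [:: 1;0;0;0;0;-1];
       [:: 1;0;-1;1;0;-1]; [:: 1;-1;0;0;1;1]; [:: 1;1;0;0;-1;1];
       [:: 0;1;-1;-1;1;0]; [:: 1;0;1;-1;0;-1]; [:: 0;1;1;1;1;0]])
  ].

Local Close Scope Z_scope.

(** * Checking the certificates and determining the spectrum *)

Lemma squares_QLS : all (fun s => QLS_table s.1 s.2) squares.
Proof. by vm_compute. Qed.

Lemma squares_card :
  [seq size (undup s.2) | s <- squares] = 6%N :: iota 8 29.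
Proof. by vm_compute. Qed.

Local Close Scope ring_scope.

Theorem corollary4p1 (R : realType) :
  Spec_QLS R 6 = [set k : nat | k = 6 \/ 8 <= k <= 36].
Proof.
apply/seteqP; split=> k /=.
  (* The dichotomy is applied with [n = 5], so its alternatives read: equal to 6, or at least 8. The
     upper bound is 6 * 6. *)
  move=> [Phi [QPhi <-]]; have [->|k8] := card_QLS_eq_or_ge QPhi; first by left.
  by right; rewrite k8 (card_QLS_le Phi).
(* The list [iota 8 29] runs from 8 to 36. *)
move=> kP; have kin : k \in 6 :: iota 8 29.
  by rewrite inE mem_iota; case: kP => [->|->]; rewrite ?orbT.
have : k \in [seq size (undup s.2) | s <- squares] by rewrite squares_card.
by case/mapP=> s sin ->; apply: Spec_QLS_table (allP squares_QLS _ sin).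
Qed.
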